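(* Let $(\mathcal C,p)$ be a universe category with universe $p:\widetilde U\to U$ and let $CC=CC(\mathcal C,p)$. There is an isomorphism of presheaves on $CC$ $$\widetilde u_1:\widetilde{\mathcal{O}b}_1\to int^{\circ}(Yo(\widetilde U))$$ such that for every $\Gamma\in CC$ and $o\in\widetilde{\mathcal{O}b}_1(\Gamma)$ one has $$\widetilde u_{1,\Gamma}(o)=int(o)\circ Q(u_{1,\Gamma}(\partial(o))).$$
   Context: Conventions. Composition is written in diagrammatic order: for $f:X\to Y$, $g:Y\to Z$ the composite is $f\circ g:X\to Z$. $\amalg_{i\in I}A_i$ denotes the set of pairs $(i,a)$, $i\in I$, $a\in A_i$. $Yo$ is the Yoneda embedding, $Yo(Y)(X)=Mor(X,Y)$. For a functor $\Phi:C\to C'$ and a presheaf $\mathcal G$ on $C'$, $\Phi^{\circ}(\mathcal G)(X)=\mathcal G(\Phi(X))$. For a morphism $p:Y\to X$, $sec(p)=\{s:X\to Y\mid s\circ p=Id_X\}$. Universes. A universe in a category $\mathcal C$ is a morphism $p:\widetilde U\to U$ with a choice, for every $F:X\to U$, of a pullback square with vertex $(X;F)$ and projections $p_F:(X;F)\to X$, $Q(F):(X;F)\to\widetilde U$, $p_F\circ F=Q(F)\circ p$. For $f:X'\to X$ and $F:X\to U$, $Q(f,F):(X';f\circ F)\to(X;F)$ is the unique morphism with $Q(f,F)\circ p_F=p_{f\circ F}\circ f$ and $Q(f,F)\circ Q(F)=Q(f\circ F)$. A universe category $(\mathcal C,p)$ is a category with a universe $p$ and a chosen final object $pt$. The C-system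 $CC(\mathcal C,p)$. Define recursively sets $Ob_n(\mathcal C,p)$ and functions $int:Ob_n(\mathcal C,p)\to Ob(\mathcal C)$: $Ob_0(\mathcal C,p)=\{tt\}$, $int(tt)=pt$; $Ob_{n+1}(\mathcal C,p)=\amalg_{A\in Ob_n(\mathcal C,p)}Mor_{\mathcal C}(int(A),U)$, $int(A,F)=(int(A);F)$. Objects of $CC(\mathcal C,p)$ are pairs $\Gamma=(n,A)$ with $A\in Ob_n(\mathcal C,p)$, and $int(\Gamma)=int(A)$. Morphisms $\Gamma'\to\Gamma$ are (copies of) the morphisms $int(\Gamma')\to int(\Gamma)$ of $\mathcal C$, so that $int:CC(\mathcal C,p)\to\mathcal C$ is a fully faithful functor. Set $l(n,A)=n$, $ft(n+1,(A,F))=(n,A)$, $ft(0,tt)=(0,tt)$; for $T=(n+1,(A,F))$, $p_T:T\to ft(T)$ is the morphism with $int(p_T)=p_F$; for such $T$ and $f:(n',A')\to(n,A)$, $f^*(T)=(n'+1,(A',int(f)\circ F))$ and $q(f,T):f^*(T)\to T$ is the morphism with $int(q(f,T))=Q(int(f),F)$. The squares $p_{f^*(T)}\circ f=q(f,T)\circ p_T$ are pullbacks. Presheaves on $CC(\mathcal C,p)$. $\mathcal{O}b_1(\Gamma)=\{T\mid l(T)=l(\Gamma)+1,\ ft(T)=\Gamma\}$ with $\mathcal{O}b_1(f)(T)=f^*(T)$. $\widetilde{\mathcal{O}b}_1(\Gamma)$ is the set of morphisms $o$ with $\partial(o):=codom(o)\in\mathcal{O}b_1(\Gamma)$ and $o\in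 sec(p_{\partial(o)})$; for $f:\Gamma'\to\Gamma$, $\widetilde{\mathcal{O}b}_1(f)(o)=f^*(o)$ is the unique element of $sec(p_{f^*(\partial(o))})$ with $f^*(o)\circ q(f,\partial(o))=f\circ o$. The isomorphism $u_1:\mathcal{O}b_1\to int^\circ(Yo(U))$ is given, for $\Gamma=(n,A)$ and $T=(n+1,(A,F))$, by $u_{1,\Gamma}(T)=F$; thus $int(T)=(int(\Gamma);u_{1,\Gamma}(T))$. *)

(* Defs.v *)
From Stdlib Require Import ClassicalEpsilon ProofIrrelevance Eqdep_dec PeanoNat.

Set Implicit Arguments.
Unset Strict Implicit.
Unset Printing Implicit Defensive.

Definition the (T : Type) (P : T -> Prop) (h : exists! x, P x) : T :=
  proj1_sig (constructive_definite_description P h).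

Lemma theP (T : Type) (P : T -> Prop) (h : exists! x, P x) : P (the h).
Proof. exact (proj2_sig (constructive_definite_description P h)). Qed.

(* Composition is in diagrammatic order: [f ;; g] is "first f, then g". *)
Record category := Category {
  Ob :> Type;
  Mor : Ob -> Ob -> Type;
  idm : forall X, Mor X X;
  comp : forall X Y Z, Mor X Y -> Mor Y Z -> Mor X Z;
  comp_id_l : forall X Y (f : Mor X Y), comp (idm X) f = f;
  comp_id_r : forall X Y (f : Mor X Y), comp f (idm Y) = f;
  comp_assoc : forall X Y Z W (f : Mor X Y) (g : Mor Y Z) (h : Mor Z W),
    comp f (comp g h) = comp (comp f g) h
}.

Arguments Mor {c} X Y.
Arguments idm {c} X.
Arguments comp {c X Y Z} f g.
Notation "f ;; g" := (comp f g) (at level 40, left associativity).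

(* A morphism with its codomain rewritten along an equality of objects. *)
Definition cast_cod (C : category) (X Y Z : C) (e : Y = Z) (f : Mor X Y) :
    Mor X Z :=
  match e in _ = Z' return Mor X Z' with eq_refl => f end.

Record functor (C D : category) := Functor {
  fobj :> C -> D;
  fmap : forall X Y, Mor X Y -> Mor (fobj X) (fobj Y);
  fmap_id : forall X, fmap (idm X) = idm (fobj X);
  fmap_comp : forall X Y Z (f : Mor X Y) (g : Mor Y Z),
    fmap (f ;; g) = fmap f ;; fmap g
}.

Arguments fmap {C D} f0 {X Y} f : rename.

Record presheaf (C : category) := Presheaf {
  psh_obj :> C -> Type;
  psh_map : forall X Y, Mor X Y -> psh_obj Y -> psh_obj X;
  psh_id : forall X (x : psh_obj X), psh_map (idm X) x = x;
  psh_comp : forall X Y Z (f : Mor X Y) (g : Mor Y Z) (x : psh_obj Z),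
    psh_map (f ;; g) x = psh_map f (psh_map g x)
}.

Arguments psh_map {C} p {X Y} f x.

Record psh_mor (C : category) (F G : presheaf C) := PshMor {
  psh_fun :> forall X : C, F X -> G X;
  psh_nat : forall (X Y : C) (f : Mor X Y) (x : F Y),
    psh_fun (psh_map F f x) = psh_map G f (psh_fun x)
}.

Definition is_psh_iso (C : category) (F G : presheaf C) (u : psh_mor F G) :
    Prop :=
  exists v : psh_mor G F,
    (forall X (x : F X), v X (u X x) = x) /\
    (forall X (y : G X), u X (v X y) = y).

Definition Yo (C : category) (Y : C) : presheaf C :=
  {| psh_obj X := Mor X Y;
     psh_map X X' f g := f ;; g;
     psh_id X g := comp_id_l g;
     psh_comp X X' X'' f g h := eq_sym (comp_assoc f g h) |}.

(* [restrict Phi G] is Phi°(G). *)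
Definition restrict (C D : category) (Phi : functor C D) (G : presheaf D) :
  presheaf C.
Proof.
refine {| psh_obj X := G (Phi X); psh_map X Y f x := psh_map G (fmap Phi f) x |}.
- intros X x. rewrite fmap_id. apply psh_id.
- intros X Y Z f g x. rewrite fmap_comp. apply psh_comp.
Defined.

Definition sec (C : category) (Y X : C) (p : Mor Y X) : Type :=
  {s : Mor X Y | s ;; p = idm X}.

Definition is_final (C : category) (T : C) : Prop :=
  forall X : C, exists! f : Mor X T, True.

Definition is_pullback (C : category) (P X Y Z : C)
    (a : Mor P X) (b : Mor P Y) (f : Mor X Z) (g : Mor Y Z) : Prop :=
  a ;; f = b ;; g /\
  forall (W : C) (x : Mor W X) (y : Mor W Y), x ;; f = y ;; g ->
    exists! h : Mor W P, h ;; a = x /\ h ;; b = y.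

(* [ext F] is the chosen vertex (X;F). *)
Record universe (C : category) := Universe {
  Utilde : C;
  U : C;
  pU : Mor Utilde U;
  ext : forall X : C, Mor X U -> C;
  proj : forall (X : C) (F : Mor X U), Mor (ext F) X;
  Q : forall (X : C) (F : Mor X U), Mor (ext F) Utilde;
  ext_pullback : forall (X : C) (F : Mor X U),
    is_pullback (proj F) (Q F) F pU
}.

Record universe_category := UniverseCategory {
  ucat :> category;
  univ : universe ucat;
  pt : ucat;
  pt_final : is_final pt
}.

Section QTwo.
Variables (C : category) (p : universe C).

Lemma ext_comm (X : C) (F : Mor X (U p)) : proj F ;; F = Q F ;; pU p.
Proof. exact (proj1 (ext_pullback F)). Qed.

Lemma ext_eq (X W : C) (F : Mor X (U p)) (h h' : Mor W (ext F)) :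
  h ;; proj F = h' ;; proj F -> h ;; Q F = h' ;; Q F -> h = h'.
Proof.
intros e1 e2.
assert (e : (h ;; proj F) ;; F = (h ;; Q F) ;; pU p).
{ rewrite <- !comp_assoc, ext_comm. reflexivity. }
destruct (proj2 (ext_pullback F) _ _ _ e) as [k [_ uniq]].
transitivity k.
- symmetry. apply uniq. split; reflexivity.
- apply uniq. split; symmetry; assumption.
Qed.

Lemma Q2_exists (X' X : C) (f : Mor X' X) (F : Mor X (U p)) :
  exists! h : Mor (ext (f ;; F)) (ext F),
    h ;; proj F = proj (f ;; F) ;; f /\ h ;; Q F = Q (f ;; F).
Proof.
apply (proj2 (ext_pullback F)).
rewrite <- comp_assoc. apply ext_comm.
Qed.

(* Q(f,F), as opposed to [Q F] = Q(F). *)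
Definition Q2 (X' X : C) (f : Mor X' X) (F : Mor X (U p)) :
  Mor (ext (f ;; F)) (ext F) := the (Q2_exists f F).

Lemma Q2_proj (X' X : C) (f : Mor X' X) (F : Mor X (U p)) :
  Q2 f F ;; proj F = proj (f ;; F) ;; f.
Proof. exact (proj1 (theP (Q2_exists f F))). Qed.

Lemma Q2_Q (X' X : C) (f : Mor X' X) (F : Mor X (U p)) :
  Q2 f F ;; Q F = Q (f ;; F).
Proof. exact (proj2 (theP (Q2_exists f F))). Qed.

Lemma sec_pullback (X' X : C) (f : Mor X' X) (F : Mor X (U p))
    (o : Mor X (ext F)) (ho : o ;; proj F = idm X) :
  exists s : Mor X' (ext (f ;; F)),
    (s ;; proj (f ;; F) = idm X' /\ s ;; Q2 f F = f ;; o) /\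
    forall s', s' ;; proj (f ;; F) = idm X' -> s' ;; Q2 f F = f ;; o -> s = s'.
Proof.
assert (e : idm X' ;; (f ;; F) = (f ;; o ;; Q F) ;; pU p).
{ rewrite comp_id_l, <- !comp_assoc, <- ext_comm, (comp_assoc o), ho, comp_id_l.
  reflexivity. }
destruct (proj2 (ext_pullback (f ;; F)) _ _ _ e) as [s [[hs1 hs2] _]].
exists s. split; [split; [exact hs1|]|].
- apply ext_eq.
  + rewrite <- comp_assoc, Q2_proj, comp_assoc, hs1, comp_id_l, <- comp_assoc,
      ho, comp_id_r. reflexivity.
  + rewrite <- comp_assoc, Q2_Q. exact hs2.
- intros s' hs' es'. apply ext_eq.
  + rewrite hs1, hs'. reflexivity.
  + rewrite hs2, <- es', <- comp_assoc, Q2_Q. reflexivity.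
Qed.

End QTwo.

Section CCSystem.
Variable C : universe_category.
Let p := univ C.

(* Ob_n(C,p) and int on it are defined by simultaneous recursion on n. *)
Fixpoint Ob_int (n : nat) : {S : Type & S -> C} :=
  match n with
  | 0 => existT (fun S : Type => S -> C) unit (fun _ => pt C)
  | S n =>
      existT (fun S : Type => S -> C)
        {A : projT1 (Ob_int n) & Mor (projT2 (Ob_int n) A) (U p)}
        (fun AF => ext (projT2 AF))
  end.

Definition Obn (n : nat) : Type := projT1 (Ob_int n).
Definition intn (n : nat) (A : Obn n) : C := projT2 (Ob_int n) A.

(* Primitive projections make [ft (ext_CC G F)] below convertible to [G]. *)
#[local] Set Primitive Projections.
Record CCob := MkOb { len : nat; obn : Obn len }.
#[local] Unset Primitive Projections.

Definition int_ob (G : CCob) : C := intn (obn G).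

Definition CC : category :=
  {| Ob := CCob;
     Mor G' G := Mor (int_ob G') (int_ob G);
     idm G := idm (int_ob G);
     comp G1 G2 G3 f g := f ;; g;
     comp_id_l G1 G2 f := comp_id_l f;
     comp_id_r G1 G2 f := comp_id_r f;
     comp_assoc G1 G2 G3 G4 f g h := comp_assoc f g h |}.

Definition int : functor CC C :=
  {| fobj := int_ob : CC -> C;
     fmap G' G (f : @Mor CC G' G) := f;
     fmap_id G := eq_refl;
     fmap_comp G1 G2 G3 f g := eq_refl |}.

Definition ft (T : CC) : CC :=
  match len T as n return Obn n -> CC with
  | 0 => fun A => MkOb (len := 0) A
  | S n => fun AF => MkOb (len := n) (projT1 AF)
  end (obn T).

(* (n+1,(A,F)) for G = (n,A) *)
Definition ext_CC (G : CC) (F : Mor (int G) (U p)) : CC :=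
  MkOb (len := S (len G)) (existT _ (obn G) F).

(* p_T : T -> ft(T); when l(T) = 0 this is the identity of T = ft(T). *)
Definition pr (T : CC) : Mor T (ft T) :=
  match len T as n
    return forall A : Obn n, @Mor CC (MkOb A) (ft (MkOb A)) with
  | 0 => fun A => idm (MkOb (len := 0) A : CC)
  | S n => fun AF => proj (projT2 AF)
  end (obn T).

(* The last component F of T = (n+1,(A,F)). *)
Definition last (T : CC) (n : nat) :
    len T = S n -> Mor (int (ft T)) (U p) :=
  match len T as m
    return forall A : Obn m, m = S n -> Mor (int (ft (MkOb A))) (U p) with
  | 0 => fun A h => False_rect _ (O_S n h)
  | S m => fun AF _ => projT2 AF
  end (obn T).

Definition Ob1_ob (G : CC) : Type :=
  {T : CC | len T = S (len G) /\ ft T = G}.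

Definition Ob1_val (G : CC) (T : Ob1_ob G) : CC := proj1_sig T.
Local Coercion Ob1_val : Ob1_ob >-> Ob.

Definition ft_Ob1 (G : CC) (T : Ob1_ob G) : ft T = G :=
  match proj2_sig T with conj _ e => e end.

Definition u1_fun (G : CC) (T : Ob1_ob G) : Mor (int G) (U p) :=
  match ft_Ob1 T in _ = G' return Mor (int G') (U p) with
  | eq_refl => last (proj1 (proj2_sig T))
  end.

(* The same p_T as [pr T], with ft(T) replaced by the equal object G. *)
Definition pr1 (G : CC) (T : Ob1_ob G) : Mor (T : CC) G :=
  cast_cod (ft_Ob1 T) (pr T).

Definition ext_Ob1 (G : CC) (F : Mor (int G) (U p)) : Ob1_ob G :=
  exist _ (ext_CC F) (conj eq_refl eq_refl).

Lemma Ob1_ind (G : CC) (P : Ob1_ob G -> Prop) :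
  (forall F, P (ext_Ob1 F)) -> forall T, P T.
Proof.
intros HP [[n A] [hl e]].
destruct n as [|n]; [discriminate hl|].
destruct A as [A F]. destruct e.
cbn in hl. assert (hl' : hl = eq_refl) by apply (UIP_dec Nat.eq_dec).
rewrite hl'. exact (HP F).
Qed.

Lemma int_Ob1 (G : CC) (T : Ob1_ob G) : int T = ext (u1_fun T).
Proof. revert T. apply Ob1_ind. reflexivity. Qed.

(* f^*(T) *)
Definition star (G' G : CC) (f : Mor G' G) (T : Ob1_ob G) : Ob1_ob G' :=
  ext_Ob1 (fmap int f ;; u1_fun T).

(* q(f,T) : the morphism with int(q(f,T)) = Q(int(f),F), whose codomain (int(G);F)
   is int(T). *)
Definition q (G' G : CC) (f : Mor G' G) (T : Ob1_ob G) :
    @Mor CC (star f T) T :=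
  cast_cod (C := C) (eq_sym (int_Ob1 T)) (Q2 (fmap int f) (u1_fun T)).

Definition Ob1 : presheaf CC.
Proof.
refine {| psh_obj := Ob1_ob; psh_map := star |}.
- intros G. apply Ob1_ind. intros F.
  unfold star. cbn. rewrite comp_id_l. reflexivity.
- intros G1 G2 G3 f g T. unfold star. cbn. rewrite comp_assoc. reflexivity.
Defined.

Definition u1 : psh_mor Ob1 (restrict int (Yo (U p))) :=
  {| psh_fun := u1_fun : forall G : CC, Ob1 G -> restrict int (Yo (U p)) G;
     psh_nat G' G f T := eq_refl |}.

Lemma u1_iso : is_psh_iso u1.
Proof.
unshelve eexists.
- refine {| psh_fun := ext_Ob1
              : forall G : CC, restrict int (Yo (U p)) G -> Ob1 G |}.
  reflexivity.
- split.
  + intros G. apply Ob1_ind. reflexivity.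
  + reflexivity.
Qed.

(* An element is a morphism o : G -> T with T in Ob1(G) and o in sec(p_T). *)
Record Obt1_ob (G : CC) := MkObt1 {
  bd : Ob1_ob G;
  sect : sec (pr1 bd)
}.

Definition mor_of (G : CC) (o : Obt1_ob G) : @Mor CC G (bd o) :=
  proj1_sig (sect o).

Lemma cast_codK (D : category) (X Y Z : D) (e : Y = Z) (f : Mor X Y) :
  cast_cod (eq_sym e) (cast_cod e f) = f.
Proof. destruct e. reflexivity. Qed.

Lemma q_ext (G' G : CC) (f : Mor G' G) (F : Mor (int G) (U p)) :
  q f (ext_Ob1 F) = Q2 (fmap int f) F.
Proof.
unfold q. rewrite (proof_irrelevance _ (int_Ob1 (ext_Ob1 F)) eq_refl).
reflexivity.
Qed.

Lemma sec_eq (D : category) (Y X : D) (r : Mor Y X) (s s' : sec r) :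
  proj1_sig s = proj1_sig s' -> s = s'.
Proof.
destruct s as [s hs], s' as [s' hs']. cbn. intros e. destruct e.
rewrite (proof_irrelevance _ hs hs'). reflexivity.
Qed.

Lemma star_sec_exists (G' G : CC) (f : Mor G' G) (T : Ob1_ob G)
    (o : sec (pr1 T)) :
  exists! s : sec (pr1 (star f T)), proj1_sig s ;; q f T = f ;; proj1_sig o.
Proof.
revert T o. refine (Ob1_ind _). intros F [o ho].
rewrite q_ext.
destruct (sec_pullback (fmap int f) (F := F) ho) as [s [[hs es] uniq]].
exists (exist (fun s : @Mor CC G' (ext_CC (fmap int f ;; F)) =>
                 s ;; pr1 (ext_Ob1 (fmap int f ;; F)) = idm G') s hs).
split; [exact es|].
intros [s' hs'] es'. apply sec_eq. exact (uniq s' hs' es').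
Qed.

(* f^*(o) *)
Definition star_sec (G' G : CC) (f : Mor G' G) (o : Obt1_ob G) : Obt1_ob G' :=
  MkObt1 (the (star_sec_exists f (sect o))).

Lemma star_secP (G' G : CC) (f : Mor G' G) (o : Obt1_ob G) :
  mor_of (star_sec f o) ;; q f (bd o) = f ;; mor_of o.
Proof. exact (theP (star_sec_exists f (sect o))). Qed.

Lemma Obt1_eq (G : CC) (F F' : Mor (int G) (U p))
    (s : sec (pr1 (ext_Ob1 F))) (s' : sec (pr1 (ext_Ob1 F'))) :
  F = F' ->
  (proj1_sig s : Mor (int G) (ext F)) ;; Q F =
  (proj1_sig s' : Mor (int G) (ext F')) ;; Q F' ->
  MkObt1 s = MkObt1 s'.
Proof.
intros eF. destruct eF. intros e. f_equal. apply sec_eq.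
apply (ext_eq (F := F)); [|exact e].
transitivity (idm (int G)); [exact (proj2_sig s)|].
symmetry. exact (proj2_sig s').
Qed.

Lemma star_sec_Q (G' G : CC) (f : Mor G' G) (F : Mor (int G) (U p))
    (s : sec (pr1 (ext_Ob1 F))) :
  (mor_of (star_sec f (MkObt1 s)) : Mor (int G') (ext (fmap int f ;; F)))
    ;; Q (fmap int f ;; F) =
  fmap int f ;; ((proj1_sig s : Mor (int G) (ext F)) ;; Q F).
Proof.
pose proof (star_secP f (MkObt1 s)) as e.
cbn [bd] in e. rewrite q_ext in e. rewrite comp_assoc.
rewrite <- (Q2_Q (fmap int f) F), comp_assoc.
exact (f_equal (fun h : Mor (int G') (ext F) => h ;; Q F) e).
Qed.

Definition Obt1 : presheaf CC.
Proof.
refine {| psh_obj := Obt1_ob; psh_map := star_sec |}.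
- intros G [T s]. revert T s. refine (Ob1_ind _). intros F s.
  apply Obt1_eq; [apply comp_id_l|].
  etransitivity; [exact (star_sec_Q (idm G) s)|]. apply comp_id_l.
- intros G1 G2 G3 f g [T s]. revert T s. refine (Ob1_ind _). intros F s.
  apply Obt1_eq; [symmetry; apply comp_assoc|].
  etransitivity; [exact (star_sec_Q (f ;; g) s)|].
  symmetry.
  etransitivity; [exact (star_sec_Q f (sect (star_sec g (MkObt1 s))))|].
  etransitivity;
    [exact (f_equal (fun h => fmap int f ;; h) (star_sec_Q g s))|].
  apply comp_assoc.
Defined.

End CCSystem.

Arguments int : clear implicits.
Arguments CC : clear implicits.
Arguments Ob1 : clear implicits.
Arguments Obt1 : clear implicits.
Arguments u1 : clear implicits.

(* Main.v *)
Require Import Defs.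
From Stdlib Require Import ProofIrrelevance.

Set Implicit Arguments.
Unset Strict Implicit.
Unset Printing Implicit Defensive.

(** An element of Obt1 over G is a type F : int G -> U together with a section
    s of the projection (int G; F) -> int G.  By the pullback property of
    (int G; F), such a section is the same as a lift y : int G -> Utilde of F
    along p, namely y = s ;; Q F.  Since F = y ;; p is then determined by y, the
    pairs (F, s) correspond bijectively to arbitrary morphisms y : int G -> Utilde
    ([sec_Q_pU] recovers F from y, [sec_of_lift] produces s, and [Obt1_unique]
    combines them).  Naturality in G is the equation star_sec_Q, which holds
    because Q2 f F ;; Q F = Q (f ;; F), and a natural family of bijections is an
    isomorphism of presheaves ([psh_iso_of_bijective]). *)

(** The inverse of a pointwise bijection is chosen by unique existence; its
    naturality follows by applying u to both sides. *)
Lemma psh_iso_of_bijective (D : category) (F G : presheaf D) (u : psh_mor F G) :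
  (forall (X : D) (y : G X), exists! x : F X, u X x = y) -> is_psh_iso u.
Proof.
intros bij.
assert (inj : forall X (x x' : F X), u X x = u X x' -> x = x').
{ intros X x x' e. destruct (bij X (u X x')) as [z [_ uniq]].
  transitivity z; [symmetry|]; apply uniq; [exact e | reflexivity]. }
assert (uK : forall X (y : G X), u X (the (bij X y)) = y).
{ intros X y. exact (theP (bij X y)). }
unshelve eexists.
- exists (fun X y => the (bij X y)).
  intros X Y f y. apply inj. rewrite psh_nat, !uK. reflexivity.
- split.
  + intros X x. apply inj. apply uK.
  + exact uK.
Qed.

Section Sections.
Variables (D : category) (p : universe D).

(** The square of F gives s ;; Q F ;; p = s ;; proj F ;; F, and s is a section. *)
Lemma sec_Q_pU (X : D) (F : Mor X (U p)) (s : Mor X (ext F)) :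
  s ;; proj F = idm X -> s ;; Q F ;; pU p = F.
Proof.
intros hs. rewrite <- comp_assoc, <- ext_comm, comp_assoc, hs.
apply comp_id_l.
Qed.

Lemma sec_of_lift (X : D) (y : Mor X (Utilde p)) :
  exists s : Mor X (ext (y ;; pU p)),
    s ;; proj (y ;; pU p) = idm X /\ s ;; Q (y ;; pU p) = y.
Proof.
destruct (proj2 (ext_pullback (y ;; pU p)) X (idm X) y (comp_id_l _))
  as [s [hs _]].
exists s. exact hs.
Qed.

End Sections.

Section Ut1.
Variable C : universe_category.

Definition ut1_fun (G : CC C) (o : Obt1 C G) :
    Mor (int C G) (Utilde (univ C)) :=
  cast_cod (int_Ob1 (bd o)) (fmap (int C) (mor_of o)) ;; Q (u1 C G (bd o)).

(** On a boundary of the form (n+1,(A,F)) the equality of objects in the cast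
    relates convertible terms, so the cast is the identity. *)
Lemma ut1_fun_ext (G : CC C) (F : Mor (int C G) (U (univ C)))
    (s : sec (pr1 (ext_Ob1 F))) :
  ut1_fun (MkObt1 s) = (proj1_sig s : Mor (int C G) (ext F)) ;; Q F.
Proof.
unfold ut1_fun. cbn [bd].
rewrite (proof_irrelevance _ (int_Ob1 (ext_Ob1 F)) eq_refl).
reflexivity.
Qed.

(** Every T in Ob1 is of the form ext_Ob1 F, so properties of Obt1 need only be
    checked there, where pr1 computes to proj F. *)
Lemma Obt1_ind (G : CC C) (P : Obt1 C G -> Prop) :
  (forall (F : Mor (int C G) (U (univ C))) (s : sec (pr1 (ext_Ob1 F))),
     P (MkObt1 s)) ->
  forall o, P o.
Proof.
intros HP [T s]. revert T s. refine (Ob1_ind _). exact HP.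
Qed.

Lemma ut1_nat (G' G : CC C) (f : Mor G' G) (o : Obt1 C G) :
  ut1_fun (psh_map (Obt1 C) f o) = fmap (int C) f ;; ut1_fun o.
Proof.
revert o. apply Obt1_ind. intros F s. rewrite ut1_fun_ext.
etransitivity; [|exact (star_sec_Q f s)].
exact (ut1_fun_ext (sect (star_sec f (MkObt1 s)))).
Qed.

Definition ut1 : psh_mor (Obt1 C) (restrict (int C) (Yo (Utilde (univ C)))) :=
  {| psh_fun := ut1_fun
       : forall G : CC C, Obt1 C G -> restrict (int C) (Yo (Utilde (univ C))) G;
     psh_nat := ut1_nat |}.

(** The boundary has to be y ;; p, and over it the section is fixed by its
    two components id and y in the pullback. *)
Lemma Obt1_unique (G : CC C) (y : Mor (int C G) (Utilde (univ C))) :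
  exists! o : Obt1 C G, ut1_fun o = y.
Proof.
destruct (sec_of_lift y) as [s [hs es]].
pose (s1 := exist (fun r : @Mor (CC C) G (ext_CC (y ;; pU (univ C))) =>
                     r ;; pr1 (ext_Ob1 (y ;; pU (univ C))) = idm G) s hs
            : sec (pr1 (ext_Ob1 (y ;; pU (univ C))))).
assert (e1 : ut1_fun (MkObt1 s1) = y).
{ rewrite ut1_fun_ext. exact es. }
exists (MkObt1 s1). split; [exact e1|].
apply (Obt1_ind (P := fun o => ut1_fun o = y -> MkObt1 s1 = o)).
intros F s' e'. rewrite ut1_fun_ext in e1, e'.
apply Obt1_eq.
- rewrite <- e'. exact (sec_Q_pU (F := F) (proj2_sig s')).
- rewrite e'. exact e1.
Qed.

End Ut1.

Theorem mainTheorem4 (C : universe_category) :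
  exists u1t : psh_mor (Obt1 C) (restrict (int C) (Yo (Utilde (univ C)))),
    is_psh_iso u1t /\
    forall (G : CC C) (o : Obt1 C G),
      u1t G o =
        cast_cod (int_Ob1 (bd o)) (fmap (int C) (mor_of o))
          ;; Q (u1 C G (bd o)).
Proof.
exists (ut1 C). split.
- apply psh_iso_of_bijective. exact (@Obt1_unique C).
- reflexivity.
Qed.
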